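(* Let $(X,d)$ be a complete generalized b-metric space and let $\varphi:\mathbb{R}_+\to\mathbb{R}_+$ be a function such that (a) $\varphi$ is nondecreasing, and (b) $\lim_{n\to\infty}\varphi^n(t)=0$ for all $t>0$, where $\varphi^n$ denotes the $n$-th iterate of $\varphi$. Suppose that the mapping $f:X\to X$ satisfies $$d(f(x),f(y))\le\varphi(d(x,y))$$ for all $x,y\in X$ with $d(x,y)<\infty$. Let $x\in X$ and consider the sequence of successive approximations $(f^n(x))_{n\in\mathbb{N}_0}$. Then either (A) $d(f^k(x),f^{k+1}(x))=+\infty$ for all $k\in\mathbb{N}_0$, or (B) the sequence $(f^n(x))_{n\in\mathbb{N}}$ is convergent to a fixed point of $f$.
   Context: A generalized b-metric on a nonempty set $X$ is a function $d:X\times X\to[0,\infty]$ (the value $+\infty$ being allowed) for which there is a fixed number $s\ge1$ such that for all $x,y,z\in X$: $d(x,y)=0\iff x=y$; $d(x,y)=d(y,x)$; and $d(x,y)\le s[d(x,z)+d(z,y)]$. The pair $(X,d)$ is called a generalized b-metric space. A sequence $(x_n)$ converges to $x$ if $d(x_n,x)\to0$; it is Cauchy if $\lim_{m,n\to\infty}d(x_n,x_m)=0$; the space is complete if every Cauchy sequence converges to some point of $X$. Here $\mathbb{R}_+=[0,\infty)$, $\mathbb{N}_0=\{0,1,2,\dots\}$, and $f^n$ denotes the $n$-th iterate of $f$, with $f^0(x)=x$. *)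

(* Defs.v *)
From HB Require Import structures.
From mathcomp Require Import all_boot all_order all_algebra.
From mathcomp Require Import all_classical all_reals all_analysis.

Set Implicit Arguments.
Unset Strict Implicit.
Unset Printing Implicit Defensive.

Import Order.TTheory GRing.Theory Num.Theory.
Import numFieldNormedType.Exports.

Local Open Scope classical_set_scope.
Local Open Scope ring_scope.

Definition generalized_b_metric (R : realType) (X : Type)
    (d : X -> X -> \bar R) : Prop :=
  (forall x y, (0 <= d x y)%E) /\
  exists s : R, [/\ 1 <= s,
    forall x y, d x y = 0%E <-> x = y,
    forall x y, d x y = d y x &
    forall x y z, (d x y <= s%:E * (d x z + d z y))%E].

Definition b_converges (R : realType) (X : Type) (d : X -> X -> \bar R)
    (u : nat -> X) (x : X) : Prop :=
  d (u n) x @[n --> \oo] --> 0%E.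

(* Joint limit, along the product filter: both indices go to infinity
   independently. *)
Definition b_cauchy (R : realType) (X : Type) (d : X -> X -> \bar R)
    (u : nat -> X) : Prop :=
  d (u p.1) (u p.2) @[p --> (\oo, \oo)] --> 0%E.

Definition b_complete (R : realType) (X : Type) (d : X -> X -> \bar R) : Prop :=
  forall u : nat -> X, b_cauchy d u -> exists x : X, b_converges d u x.

(* Main.v *)
Require Import Defs.
From HB Require Import structures.
From mathcomp Require Import all_boot all_order all_algebra.
From mathcomp Require Import all_classical all_reals all_analysis.
From mathcomp Require Import ring zify.

Set Implicit Arguments.
Unset Strict Implicit.
Unset Printing Implicit Defensive.

Import Order.TTheory GRing.Theory Num.Theory.
Import numFieldNormedType.Exports.

Local Open Scope classical_set_scope.
Local Open Scope ring_scope.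

(** By monotonicity [d (f^n y) (f^n z) <= phi^n t] whenever [d y z <= t], and
    [phi t <= t]. Suppose [d x (f x)] is finite, and let [e > 0]. Choose [n]
    with [phi^n e <= e / (2s)], then [k] so large that [x_k, ..., x_{k+n}] all
    lie within [e / (2s)] of [x_k]. The relaxed triangle inequality
    shows that [f^n] maps the orbit points of the closed ball of radius [e]
    around [x_k] into that ball, so the orbit never leaves it after step [k]. Hence
    the orbit is Cauchy, and its limit is fixed because [f] is continuous. *)

(** Neighbourhoods of [0%E] come from real neighbourhoods of 0, and a real bound rules out infinite
    values. The filter is arbitrary to cover both [b_converges] and the joint limit in
    [b_cauchy]. *)
Lemma nneg_cvge0P (R : realType) (T : Type) (F : set_system T) (u : T -> \bar R) :
  Filter F -> (forall p, (0 <= u p)%E) ->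
  u p @[p --> F] --> 0%E <->
  forall e : R, 0 < e -> \forall p \near F, (u p <= e%:E)%E.
Proof.
move=> FF u_ge0; split=> [u0 e e0|u_small A].
  apply: (u0 [set y | (y <= e%:E)%E]).
  change (nbhs (0 : R) (fun r : R => (r%:E <= e%:E)%E)).
  near=> r; rewrite lee_fin ltW //.
  by near: r; exact: lt_nbhsl.
change (nbhs (0 : R) (fun r : R => A r%:E) -> F (fun p => A (u p))).
move=> /nbhs_ballP[e /= e0 ballA].
have e20 : 0 < e / 2 by rewrite divr_gt0.
apply: filterS (u_small _ e20) => p.
move: (u_ge0 p); case: (u p) => [r||] //; rewrite !lee_fin => r0 re.
apply: ballA; rewrite /ball /= sub0r normrN ger0_norm //.
by rewrite (le_lt_trans re)// ltr_pdivrMr// ltr_pMr// ltr1n.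
Unshelve. all: by end_near. Qed.

Section comparison_function.
Variables (R : realType) (phi : R -> R).
Hypotheses (phi_ge0 : forall t : R, 0 <= t -> 0 <= phi t)
  (phi_nondecreasing : forall t u : R, 0 <= t -> t <= u -> phi t <= phi u)
  (phi_iter : forall t : R, 0 < t -> iter n phi t @[n --> \oo] --> (0 : R)).

Lemma iter_phi_ge0 n t : 0 <= t -> 0 <= iter n phi t.
Proof. by move=> t0; elim: n => //= n; exact: phi_ge0. Qed.

Lemma near_iter_phi_le t e : 0 < t -> 0 < e ->
  \forall n \near \oo, iter n phi t <= e.
Proof.
by move=> t0 e0; exact: cvgr_le (phi_iter t0) e e0.
Qed.

(** If [t < phi t], monotonicity keeps all iterates above [t], so they cannot tend to 0. *)
Lemma phi_le t : 0 < t -> phi t <= t.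
Proof.
move=> t0; rewrite leNgt; apply/negP => tphi.
have t_iter n : t <= iter n phi t.
  elim: n => //= n IH; apply: le_trans (ltW tphi) _.
  by apply: phi_nondecreasing => //; exact: ltW.
have t20 : 0 < t / 2 by rewrite divr_gt0.
have [n _ /(_ n (leqnn n))/(le_trans (t_iter n))] := near_iter_phi_le t0 t20.
by rewrite leNgt ltr_pdivrMr// ltr_pMr// ltr1n.
Qed.

Variables (X : Type) (d : X -> X -> \bar R) (f : X -> X).
Hypotheses (d_ge0 : forall x y, (0 <= d x y)%E)
  (f_contr : forall y z : X, (d y z < +oo)%E ->
     (d (f y) (f z) <= (phi (fine (d y z)))%:E)%E).

Lemma contr_le y z t : (d y z <= t%:E)%E -> (d (f y) (f z) <= (phi t)%:E)%E.
Proof.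
move=> yzt; have yz_oo : (d y z < +oo)%E by exact: le_lt_trans yzt (ltry _).
have yz_fin : d y z \is a fin_num by rewrite ge0_fin_numE.
apply: le_trans (f_contr yz_oo) _; rewrite lee_fin; apply: phi_nondecreasing.
  exact: fine_ge0.
by rewrite -lee_fin fineK.
Qed.

Lemma iter_contr_le n y z t : (d y z <= t%:E)%E ->
  (d (iter n f y) (iter n f z) <= (iter n phi t)%:E)%E.
Proof. by move=> yzt; elim: n => //= n; exact: contr_le. Qed.

Variable s : R.
Hypotheses (s_ge1 : 1 <= s) (d_eq0 : forall x y, d x y = 0%E <-> x = y)
  (d_sym : forall x y, d x y = d y x)
  (d_triangle : forall x y z, (d x y <= s%:E * (d x z + d z y))%E).

Lemma triangle_le a b x y z : (d x z <= a%:E)%E -> (d z y <= b%:E)%E ->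
  (d x y <= (s * (a + b))%:E)%E.
Proof.
move=> xza zyb; apply: le_trans (d_triangle x y z) _.
rewrite EFinM EFinD; apply: lee_wpmul2l; last exact: leeD.
by rewrite lee_fin (le_trans ler01).
Qed.

Lemma halve_triangle_bound e : 0 < e -> exists2 c, 0 < c & s * (c + c) = e.
Proof.
have s0 : 0 < s by exact: lt_le_trans ltr01 s_ge1.
move=> e0; exists (e / (2 * s)); first by rewrite divr_gt0// mulr_gt0.
by field; rewrite gt_eqF.
Qed.

Lemma dist_refl x : d x x = 0%E.
Proof. exact/d_eq0. Qed.

Lemma orbit_segment_bounded x n : (d x (f x) < +oo)%E ->
  exists2 D, 0 < D & forall i, (i <= n)%N -> (d x (iter i f x) <= D%:E)%E.
Proof.
move=> xfx; elim: n => [|n [D D0 xD]].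
  by exists 1 => // i; rewrite leqn0 => /eqP ->; rewrite dist_refl lee_fin.
have xfx_fin : d x (f x) \is a fin_num by rewrite ge0_fin_numE.
pose b := fine (d x (f x)).
have b0 : 0 <= b by exact: fine_ge0.
have stepb : (d x (f x) <= b%:E)%E by rewrite fineK.
(* Triangle bound through the [n]-th iterate; since [1 <= s], it also dominates the old [D]. *)
exists (s * (D + iter n phi b)).
  by apply: mulr_gt0; [exact: lt_le_trans ltr01 s_ge1|rewrite ltr_wpDr ?iter_phi_ge0].
move=> i; rewrite leq_eqVlt => /orP[/eqP ->|i_n].
  apply: triangle_le (xD n (leqnn n)) _.
  by rewrite iterSr; exact: iter_contr_le.
apply: le_trans (xD i i_n) _; rewrite lee_fin.
apply: (@le_trans _ _ (D + iter n phi b)).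
  by rewrite lerDl iter_phi_ge0.
by rewrite ler_peMl// addr_ge0 ?iter_phi_ge0// ltW.
Qed.

Lemma orbit_tail_in_ball x e : (d x (f x) < +oo)%E -> 0 < e ->
  exists k, forall n, (d (iter k f x) (iter (k + n) f x) <= e%:E)%E.
Proof.
move=> xfx e0; have [c c0 scc] := halve_triangle_bound e0.
have ce : c <= e.
  have c_ge0 := ltW c0.
  by rewrite -scc (@le_trans _ _ (c + c)) ?lerDl// ler_peMl// addr_ge0.
(* Taking [N.+1] instead of [N] makes the block length positive, so the strong induction below
   descends. *)
have [N _ /(_ N.+1 (leqnSn N)) /= phiN] := near_iter_phi_le e0 c0.
have [D D0 xD] := orbit_segment_bounded N.+1 xfx.
(* [k] is chosen after [D]: [k] further steps shrink the whole initial segment to size [c]. *)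
have [k _ /(_ k (leqnn k)) /= phik] := near_iter_phi_le D0 c0.
have seg i : (i <= N.+1)%N -> (d (iter k f x) (iter (k + i) f x) <= c%:E)%E.
  move=> iN; rewrite iterD; apply: le_trans (iter_contr_le k (xD i iN)) _.
  by rewrite lee_fin.
exists k => n; elim/ltn_ind: n => n IH.
have [nN|Nn] := leqP n N.+1.
  by apply: le_trans (seg n nN) _; rewrite lee_fin.
rewrite -scc; apply: (triangle_le (seg N.+1 (leqnn _))).
(* Both points become images under [iter N.+1 f]: one of the centre, the other of an earlier orbit
   point, within [e] of it by induction. *)
have -> : (k + n = N.+1 + (k + (n - N.+1)))%N by lia.
rewrite addnC !(iterD N.+1).
apply: (@le_trans _ _ (iter N.+1 phi e)%:E); last by rewrite lee_fin.
by apply: iter_contr_le; apply: IH; lia.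
Qed.

(** Two points of the tail are compared through the centre of a ball of radius [c] containing it. *)
Lemma orbit_cauchy x : (d x (f x) < +oo)%E ->
  b_cauchy d (fun n => iter n f x).
Proof.
move=> xfx; apply/nneg_cvge0P => // e e0.
have [c c0 scc] := halve_triangle_bound e0.
have [k xk] := orbit_tail_in_ball xfx c0.
exists ([set n | (k <= n)%N], [set n | (k <= n)%N]).
  by split; exact: nbhs_infty_ge.
move=> [m p] /= [km kp]; rewrite -scc -(subnKC km) -(subnKC kp).
apply: triangle_le (xk _).
by rewrite d_sym.
Qed.

(** For large [n], the iterate [n.+1] is within [c] of [z], and within [phi c <= c] of [f z]. *)
Lemma orbit_limit_fixed x z :
  b_converges d (fun n => iter n f x) z -> f z = z.
Proof.
move=> /(nneg_cvge0P _ (fun n => d_ge0 _ _)) x_z.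
apply/d_eq0/eqP; rewrite eq_le d_ge0 andbT; apply/lee_addgt0Pr => e e0.
rewrite add0e; have [c c0 scc] := halve_triangle_bound e0.
have [n _ xn] := x_z c c0.
rewrite -scc; apply: (@triangle_le c c _ _ (iter n.+1 f x)).
  rewrite d_sym /=; apply: le_trans (contr_le (xn n (leqnn n))) _.
  by rewrite lee_fin phi_le.
exact: xn (leqnSn n).
Qed.

End comparison_function.

(* A map phi from R_+ to R_+ is given by phi : R -> R preserving the
   nonnegative reals; its values at negative reals are never used. *)
Theorem theorem3p7 (R : realType) (X : Type) (d : X -> X -> \bar R)
    (phi : R -> R) (f : X -> X) (x : X)
    (d_bmetric : generalized_b_metric d)
    (d_complete : b_complete d)
    (phi_ge0 : forall t : R, 0 <= t -> 0 <= phi t)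
    (phi_nondecreasing : forall t u : R, 0 <= t -> t <= u -> phi t <= phi u)
    (phi_iter : forall t : R, 0 < t -> iter n phi t @[n --> \oo] --> (0 : R))
    (f_contr : forall y z : X, (d y z < +oo)%E ->
       (d (f y) (f z) <= (phi (fine (d y z)))%:E)%E) :
  (forall k : nat, d (iter k f x) (iter k.+1 f x) = +oo%E) \/
  (exists z : X, f z = z /\ b_converges d (fun n => iter n f x) z).
Proof.
have [d_ge0 [s [s_ge1 d_eq0 d_sym d_triangle]]] := d_bmetric.
have [?|/existsNP[k xk]] :=
  pselect (forall k, d (iter k f x) (iter k.+1 f x) = +oo%E); first by left.
right.
(* The orbit is restarted at [iter k f x]; the index shift is undone at the end. *)
have xk_fin : (d (iter k f x) (f (iter k f x)) < +oo)%E.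
  by rewrite ltey; exact/eqP.
have [z xz] := d_complete _ (orbit_cauchy phi_ge0 phi_nondecreasing phi_iter
  d_ge0 f_contr s_ge1 d_eq0 d_sym d_triangle xk_fin).
exists z; split.
  exact: (orbit_limit_fixed phi_nondecreasing phi_iter
    d_ge0 f_contr s_ge1 d_eq0 d_sym d_triangle xz).
rewrite /b_converges in xz *; rewrite -(cvg_shiftn k); move: xz.
by under eq_fun do rewrite -iterD.
Qed.
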